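(* Let $H$ be a finite connected graph with $v\ge2$ vertices which is not a tree, and let $\widetilde H$ be its $2$-core, with $\widetilde v$ vertices, $\widetilde e$ edges and maximum degree $\widetilde\Delta$. Let $\mathcal G_n$ be the Erdős–Rényi random graph on $[n]$ with edge probability $p_n$, where $(n\log n)^{-1/\widetilde\Delta}\ll p_n\ll1$. Then $$\sup_{S\subseteq[n]}n^{-\widetilde v}\left|p_n^{-\widetilde e}\mathcal N_{\widetilde H}(S;\mathcal G_n)-(|S|)_{\widetilde v}\right|\to0\quad\text{in probability as }n\to\infty.$$
   Context: $[m]:=\{1,\ldots,m\}$; $a_n\ll b_n$ means $a_n/b_n\to0$. The $2$-core of $H$ is the maximal subgraph of $H$ in which all vertices have degree at least $2$. The random graph: $\mathcal G_n(i,j)\sim\mathrm{Ber}(p_n)$ independently for $i<j$, $\mathcal G_n(i,j)=\mathcal G_n(j,i)$, $\mathcal G_n(i,i)=0$. For $S\subseteq[n]$ and a graph $F$, $$\mathcal N_F(S;\mathcal G_n):=\sum_{\varphi:V(F)\hookrightarrow S}\ \prod_{\{a,b\}\in E(F)}\mathcal G_n(\varphi(a),\varphi(b)),$$ the sum being over injective maps $\varphi:V(F)\to S$. $(m)_d:=m(m-1)\cdots(m-d+1)$ and $(m)_0:=1$. *)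

(* Defs.v *)
From HB Require Import structures.
From mathcomp Require Import all_boot all_order all_algebra.
From mathcomp Require Import all_classical all_reals all_analysis.

Set Implicit Arguments.
Unset Strict Implicit.
Unset Printing Implicit Defensive.

Import Order.TTheory GRing.Theory Num.Theory.
Import numFieldNormedType.Exports.

Local Open Scope classical_set_scope.
Local Open Scope ring_scope.

Record sgraph := SGraph {
  vertex :> finType;
  adj : rel vertex;
  adj_sym : symmetric adj;
  adj_irr : irreflexive adj }.

(* Every edge {a, b} is listed exactly once, as the pair (a, b) or (b, a) that
   is increasing for the enumeration of the vertex type. *)
Definition edges (F : sgraph) : {set F * F} :=
  [set ab : F * F | adj ab.1 ab.2 & (enum_rank ab.1 < enum_rank ab.2)%N].

Definition degree (F : sgraph) (x : F) : nat := #|[set y : F | adj x y]%SET|.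

Definition max_degree (F : sgraph) : nat := \max_(x : F) degree x.

Definition connected_graph (F : sgraph) : Prop :=
  forall x y : F, connect (@adj F) x y.

(* [ucycle] also accepts the closed walk x, y, x along a single edge, of
   size 2; genuine cycles are those of size at least 3. *)
Definition acyclic (F : sgraph) : Prop :=
  forall s : seq F, ucycle (@adj F) s -> (size s < 3)%N.

Definition is_tree (F : sgraph) : Prop := connected_graph F /\ acyclic F.

Record subgraph (H : sgraph) := Subgraph {
  sub_verts : {set H};
  sub_adj : rel H;
  sub_adj_sym : symmetric sub_adj;
  sub_adjP : forall x y, sub_adj x y ->
    [/\ x \in sub_verts, y \in sub_verts & adj x y] }.

Definition sub_rel (H : sgraph) (K : subgraph H) :
    rel {x : H | x \in sub_verts K} :=
  fun x y => sub_adj K (val x) (val y).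

Lemma sub_rel_sym (H : sgraph) (K : subgraph H) : symmetric (sub_rel (K := K)).
Proof. by move=> x y; exact: sub_adj_sym. Qed.

Lemma sub_rel_irr (H : sgraph) (K : subgraph H) : irreflexive (sub_rel (K := K)).
Proof.
by move=> x; apply/negP => /sub_adjP[_ _]; rewrite adj_irr.
Qed.

Definition sgraph_of_subgraph (H : sgraph) (K : subgraph H) : sgraph :=
  SGraph (@sub_rel_sym H K) (@sub_rel_irr H K).

Coercion sgraph_of_subgraph : subgraph >-> sgraph.

Definition subgraph_le (H : sgraph) (K L : subgraph H) : Prop :=
  sub_verts K \subset sub_verts L /\
  forall x y, sub_adj K x y -> sub_adj L x y.

Definition min_degree_ge2 (F : sgraph) : Prop :=
  forall x : F, (2 <= degree x)%N.

Definition is_two_core (H : sgraph) (K : subgraph H) : Prop :=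
  min_degree_ge2 K /\
  forall L : subgraph H, min_degree_ge2 L -> subgraph_le K L -> subgraph_le L K.

Definition inj_count (F : sgraph) (n : nat) (S : {set 'I_n}) (g : rel 'I_n)
    : nat :=
  (\sum_(phi : {ffun F -> 'I_n} | injectiveb phi && [forall x, phi x \in S])
    \prod_(ab in edges F) g (phi ab.1) (phi ab.2))%N.

Definition mutually_independent (R : realType) (d d' : measure_display)
    (T : measurableType d) (U : measurableType d') (P : probability T R)
    (I : finType) (A : {set I}) (X : I -> {RV P >-> U}) : Prop :=
  forall (J : {set I}) (B : I -> set U), J \subset A ->
    (forall i, i \in J -> measurable (B i)) ->
    P (\bigcap_(i in [set` J]) X i @^-1` B i) =
    (\prod_(i in J) P (X i @^-1` B i))%E.

Definition erdos_renyi (R : realType) (d : measure_display)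
    (T : measurableType d) (P : probability T R) (n : nat) (p : R)
    (G : 'I_n -> 'I_n -> {RV P >-> bool}) : Prop :=
  [/\ forall i j w, G i j w = G j i w,
      forall i w, G i i w = false,
      forall i j : 'I_n, (i < j)%N ->
        forall B : set bool, distribution P (G i j) B = bernoulli_prob p B &
      mutually_independent [set ij : 'I_n * 'I_n | (ij.1 < ij.2)%N]%SET
        (fun ij => G ij.1 ij.2)].

(* Division by 0 yields 0 here, so that the ratio being eventually defined has
   to be required explicitly. *)
Definition much_less (R : realType) (a b : nat -> R) : Prop :=
  (\forall n \near \oo, b n != 0) /\ (a n / b n @[n --> \oo] --> (0 : R)).

Definition cvg_in_probability (R : realType) (d : nat -> measure_display)
    (T : forall n, measurableType (d n)) (P : forall n, probability (T n) R)
    (X : forall n, T n -> R) (l : R) : Prop :=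
  forall eps : R, 0 < eps ->
    P n [set w | eps < `|X n w - l|] @[n --> \oo] --> 0%E.

(* The supremum ranges over the finitely many subsets S, and the values are
   nonnegative, so that it is a maximum and 0 is a neutral element. *)
Definition sup_deviation (R : realType) (F : sgraph) (n : nat) (p : R)
    (g : rel 'I_n) : R :=
  \big[Num.max/0]_(S : {set 'I_n})
    ((n%:R ^- #|F|) *
     `|p ^- #|edges F| * (inj_count F S g)%:R - (#|S| ^_ #|F|)%:R|).

(* Main.v *)
(* Only lower tails are needed.  Fix S and let A be the set of all injections of
   the 2-core into S, or the complement of that set among all injections into
   [n].  Janson's inequality bounds the probability that the number of present
   copies indexed by A falls eps n^v p^e below its mean by exp(- c eps^2 / B),
   where B n^(2v) p^(2e) bounds the sum of P(both copies present) over pairs of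
   copies sharing an edge.  A pair whose images share k vertices shares m edges
   with 2m <= k min(Delta, k - 1), whence n B -> 0 as soon as
   p^(-Delta) <= n^(5/4); so a union bound over the 2^n sets S applies.
   Chebyshev's inequality controls the total number of copies from above, and the
   upper bound for S is the one for the total minus the lower bound for the
   complementary family. *)
Require Import Defs.
From HB Require Import structures.
From mathcomp Require Import all_boot all_order all_algebra.
From mathcomp Require Import ring lra zify.
From mathcomp Require Import all_classical all_reals all_analysis.

Set Implicit Arguments.
Unset Strict Implicit.
Unset Printing Implicit Defensive.

Import Order.TTheory GRing.Theory Num.Theory.
Import numFieldNormedType.Exports.

Local Open Scope ring_scope.

(** * Random subsets with independent elements *)

Section BernoulliExpectation.
Variables (R : realFieldType) (E : finType) (q : E -> R).

(** Law of the random subset that contains each [e] independently with probability [q e]. All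
    probability is done with such finite sums and transferred to the random graph at the end. *)
Definition weight (x : {set E}) : R :=
  \prod_e (if e \in x then q e else 1 - q e).

Definition expect (f : {set E} -> R) : R := \sum_x weight x * f x.

Lemma expectD f g : expect (fun x => f x + g x) = expect f + expect g.
Proof. by rewrite -big_split; apply: eq_bigr => x _; rewrite mulrDr. Qed.

Lemma expectZ c f : expect (fun x => c * f x) = c * expect f.
Proof. by rewrite big_distrr; apply: eq_bigr => x _; rewrite /= mulrCA. Qed.

Lemma expect_sum (I : finType) (P : pred I) (f : I -> {set E} -> R) :
  expect (fun x => \sum_(i | P i) f i x) = \sum_(i | P i) expect (f i).
Proof.
by rewrite exchange_big; apply: eq_bigr => x _; rewrite big_distrr.
Qed.

Lemma eq_expect f g : f =1 g -> expect f = expect g.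
Proof. by move=> fg; apply: eq_bigr => x _; rewrite fg. Qed.

Lemma expect_cst c : expect (fun=> c) = c.
Proof.
rewrite /expect -mulr_suml -[X in X * _](_ : 1 = _) ?mul1r//.
rewrite -(bigA_distr _ _ q (fun e => 1 - q e)).
by rewrite big1// => e _; rewrite /= addrC subrK.
Qed.

Let rest e (x : {set E}) : R :=
  \prod_(i | i != e) (if i \in x then q i else 1 - q i).

Let restU e x : rest e (e |: x) = rest e x.
Proof. by apply: eq_bigr => i /negPf ie; rewrite !inE ie. Qed.

(** Conditioning on the presence of [e]: each [x] without [e] is paired with [e |: x], and [rest] is
    the weight of the other elements. *)
Lemma expect_split e f : expect f =
  \sum_(x : {set E} | e \notin x)
    rest e x * (q e * f (e |: x) + (1 - q e) * f x).
Proof.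
have wE x : weight x = (if e \in x then q e else 1 - q e) * rest e x.
  by rewrite /weight (bigD1 e).
rewrite /expect (bigID (fun x : {set E} => e \in x)) /=.
rewrite (reindex_onto (fun x => e |: x) (fun x => x :\ e)); last first.
  by move=> x ex; rewrite finset.setD1K.
rewrite [X in X + _](eq_bigl (fun x : {set E} => e \notin x)); last first.
  move=> x /=; rewrite finset.setU11 /=.
  apply/eqP/idP => [<-|]; last exact: finset.setU1K.
  by rewrite !inE eqxx.
rewrite -big_split; apply: eq_bigr => x /negPf ex /=.
by rewrite !wE restU finset.setU11 ex; ring.
Qed.

(** Conditional expectation given the status of every element other than [e]. *)
Definition average e (f : {set E} -> R) (x : {set E}) : R :=
  q e * f (e |: x) + (1 - q e) * f (x :\ e).

Definition averages (s : seq E) f := foldr average f s.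

Lemma expect_average e f : expect (average e f) = expect f.
Proof.
rewrite !(expect_split e); apply: eq_bigr => x ex; congr (_ * _).
have De : x :\ e = x.
  by apply/finset.setP => i; rewrite !inE; case: eqP => // ->; rewrite (negPf ex).
by rewrite /average finset.setU1K// De finset.setUA finset.setUid; ring.
Qed.

Lemma expect_averages s f : expect (averages s f) = expect f.
Proof. by elim: s => //= e s <-; rewrite expect_average. Qed.

Lemma expect_cond1 e f : (forall x, f (e |: x) = f x) ->
  expect (fun x => (e \in x)%:R * f x) = q e * expect f.
Proof.
move=> fe; rewrite !(expect_split e) mulr_sumr; apply: eq_bigr => x /negPf ex.
by rewrite finset.setU11 fe ex mul0r mul1r; ring.
Qed.

Definition pr_all (a : {set E}) : R := \prod_(e in a) q e.

(** Independence: [f] ignores the elements of [a], so their presence factors out, one element at a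
    time. *)
Lemma expect_cond (a : {set E}) f : (forall e x, e \in a -> f (e |: x) = f x) ->
  expect (fun x => (a \subset x)%:R * f x) = pr_all a * expect f.
Proof.
move=> fa; rewrite /pr_all -big_enum /=.
have {fa}: forall e x, e \in enum a -> f (e |: x) = f x.
  by move=> e x; rewrite mem_enum; exact: fa.
rewrite (@eq_expect _ (fun x => (all (fun e => e \in x) (enum a))%:R * f x)); last first.
  move=> x; congr ((nat_of_bool _)%:R * _); apply/fintype.subsetP/allP => sub e.
    by rewrite mem_enum; exact: sub.
  by rewrite -mem_enum; exact: sub.
elim: (enum a) (enum_uniq a) => [|e s IH] /=.
  by move=> _ _; rewrite big_nil mul1r; apply: eq_expect => x; rewrite mul1r.
move=> /andP[es us] fs; rewrite big_cons -mulrA -IH//; last first.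
  by move=> e' x e's; apply: fs; rewrite inE e's orbT.
rewrite -expect_cond1 => [|x]; last first.
  rewrite fs ?mem_head//; congr ((nat_of_bool _)%:R * _).
  apply: eq_in_all => e' e's; rewrite !inE; case: eqP => // e'e.
  by rewrite -e'e e's in es.
by apply: eq_expect => x; rewrite mulrA -natrM mulnb.
Qed.

Lemma expect_all (a : {set E}) : expect (fun x => (a \subset x)%:R) = pr_all a.
Proof.
have := @expect_cond a (fun=> 1) (fun _ _ _ => erefl).
by rewrite expect_cst mulr1 => <-; apply: eq_expect => x; rewrite mulr1.
Qed.

Lemma pr_allU (a b : {set E}) : [disjoint a & b] ->
  pr_all (a :|: b) = pr_all a * pr_all b.
Proof.
move=> ab; rewrite /pr_all -bigU//=.
by apply: eq_bigl => e; rewrite !inE.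
Qed.

Hypothesis q01 : forall e, 0 <= q e <= 1.

Lemma weight_ge0 x : 0 <= weight x.
Proof.
apply: prodr_ge0 => e _; have /andP[q0 q1] := q01 e.
by case: ifP => // _; rewrite subr_ge0.
Qed.

Lemma pr_all_ge0 a : 0 <= pr_all a.
Proof. by apply: prodr_ge0 => e _; have /andP[] := q01 e. Qed.

Lemma le_expect f g : (forall x, f x <= g x) -> expect f <= expect g.
Proof.
by move=> fg; apply: ler_sum => x _; apply: ler_wpM2l; rewrite ?weight_ge0.
Qed.

Lemma expect_ge0 f : (forall x, 0 <= f x) -> 0 <= expect f.
Proof. by move=> f0; rewrite -[leLHS](expect_cst 0); exact: le_expect. Qed.

Definition antitone (f : {set E} -> R) :=
  forall x y : {set E}, x \subset y -> f y <= f x.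

Lemma antitone_average e f : antitone f -> antitone (average e f).
Proof.
move=> af x y xy; have /andP[q0 q1] := q01 e.
apply: lerD; apply: ler_wpM2l; rewrite ?subr_ge0 //; apply: af.
  exact: finset.setUS.
exact: finset.setSD.
Qed.

Lemma antitone_averages s f : antitone f -> antitone (averages s f).
Proof. by move=> af; elim: s => //= e s; exact: antitone_average. Qed.

Lemma averagesM s f g : antitone f -> antitone g -> forall x,
  averages s f x * averages s g x <= averages s (fun x => f x * g x) x.
Proof.
move=> af ag; elim: s => //= e s IH x; have /andP[q0 q1] := q01 e.
apply: (@le_trans _ _
  (average e (fun x => averages s f x * averages s g x) x)); last first.
  by apply: lerD; apply: ler_wpM2l; rewrite ?subr_ge0.
have sub : x :\ e \subset e |: x.
  exact: fintype.subset_trans (finset.subsetDl _ _) (finset.subsetUr _ _).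
rewrite /average.
have := antitone_averages s af sub; have := antitone_averages s ag sub.
move: (averages s f _) (averages s f _) => a b.
move: (averages s g _) (averages s g _) => c d cd ab.
(* The gap is the covariance of two functions of the status of [e]. Both decrease when [e] is added,
   so the differences have the same sign. *)
rewrite -subr_ge0 [leRHS](_ : _ = q e * (1 - q e) * ((a - b) * (c - d))).
  by rewrite !mulr_ge0 ?subr_ge0.
by ring.
Qed.

Lemma averages_cst s f (x y : {set E}) :
  (forall e, e \notin s -> (e \in x) = (e \in y)) ->
  averages s f x = averages s f y.
Proof.
elim: s x y => [|e s IH] x y xy /=.
  by congr (f _); apply/finset.setP => e; rewrite xy.
by congr (_ * _ + _ * _); apply: IH => e' e's; rewrite !inE;
  case: eqP => //= /eqP e'e; apply: xy; rewrite inE negb_or e'e.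
Qed.

Lemma expectE_averages f x : expect f = averages (enum E) f x.
Proof.
rewrite -(expect_averages (enum E)) -[RHS]expect_cst; apply: eq_expect => y.
by apply: averages_cst => e; rewrite mem_enum.
Qed.

(* Averaging out one element preserves antitonicity, and [average e (f * g)]
   dominates [average e f * average e g]; once all elements are averaged out,
   only the constants [expect _] remain. *)
Lemma harris f g : antitone f -> antitone g ->
  expect f * expect g <= expect (fun x => f x * g x).
Proof.
by move=> af ag; rewrite !(expectE_averages _ finset.set0); exact: averagesM.
Qed.

End BernoulliExpectation.

(** * Janson's inequality *)

Section Janson.
Variables (R : realType) (E : finType) (q : E -> R).
Hypothesis q01 : forall e, 0 <= q e <= 1.
Variables (I : finType) (a : I -> {set E}).

Definition occurrences (A : {set I}) (x : {set E}) : R :=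
  \sum_(i in A) (a i \subset x)%:R.

Definition mean (A : {set I}) : R := \sum_(i in A) pr_all q (a i).

(** Janson's correlation sum over ordered pairs, diagonal pairs of nonempty [a i] included. *)
Definition correlation (A : {set I}) : R :=
  \sum_(i in A) \sum_(j in A | ~~ [disjoint a i & a j]) pr_all q (a i :|: a j).

Lemma expect_occurrences A : expect q (occurrences A) = mean A.
Proof.
by rewrite expect_sum; apply: eq_bigr => i _; rewrite expect_all.
Qed.

(** All terms are nonnegative. One bound for the family of all injections thus serves each of its
    subfamilies. *)
Lemma le_correlation (A B : {set I}) : A \subset B ->
  correlation A <= correlation B.
Proof.
move=> /fintype.subsetP AB; rewrite /correlation [leRHS](bigID (mem A)) /=.
rewrite -[leLHS]addr0 lerD//; last first.
  by apply: sumr_ge0 => i _; apply: sumr_ge0 => j _; exact: pr_all_ge0.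
rewrite [leRHS](eq_bigl (mem A)) => [|i]; last first.
  by rewrite /= andb_idl// => /AB.
apply: ler_sum => i _; rewrite [leRHS](bigID (mem A)) /=.
rewrite -[leLHS]addr0 lerD//; last first.
  by apply: sumr_ge0 => j _; exact: pr_all_ge0.
rewrite le_eqVlt; apply/orP; left; apply/eqP; apply: eq_bigl => j.
by have [/AB ->|] := boolP (j \in A); rewrite ?andbT ?andbF.
Qed.

Let mgf (A : {set I}) (s : R) := expect q (fun x => expR (- (s * occurrences A x))).

(* When [a i] is present, the count splits as [Y + Z] with [Z] running over the
   [a j] disjoint from [a i], hence independent of its presence; Harris'
   inequality separates the two factors and [expR (- y) >= 1 - y] bounds the one
   for [Y]. *)
Lemma expect_occurrence_expR (A : {set I}) (s : R) i : 0 <= s ->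
  (pr_all q (a i) -
     s * \sum_(j in A | ~~ [disjoint a i & a j]) pr_all q (a i :|: a j)) * mgf A s
  <= expect q (fun x => (a i \subset x)%:R * expR (- (s * occurrences A x))).
Proof.
move=> s0.
(* Evaluating on [x :|: a i] makes [Y] blind to the elements of [a i], without changing it when
   [a i] is present. *)
pose Y (x : {set E}) : R :=
  \sum_(j in A | ~~ [disjoint a i & a j]) (a j \subset x :|: a i)%:R.
pose Z (x : {set E}) : R := \sum_(j in A | [disjoint a i & a j]) (a j \subset x)%:R.
have absorb e (x : {set E}) : e \in a i -> (e |: x) :|: a i = x :|: a i.
  move=> ei; apply/finset.setP => e'.
  by rewrite !inE; case: eqP => [->|]; rewrite ?ei ?orbT.
have anti (B : pred I) (b : {set E}) : antitone (fun x : {set E} =>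
    expR (- (s * \sum_(j in A | B j) (a j \subset x :|: b)%:R))).
  move=> x y xy; rewrite ler_expR lerN2 ler_wpM2l// ler_sum// => j _.
  rewrite ler_nat; case: (boolP (_ \subset x :|: b)) => //= jx.
  by rewrite (fintype.subset_trans jx)// finset.setSU.
have antiY : antitone (fun x => expR (- (s * Y x))) by exact: anti.
have antiZ : antitone (fun x => expR (- (s * Z x))).
  move=> x y xy; have := anti (fun j => [disjoint a i & a j]) finset.set0 x y xy.
  by rewrite !finset.setU0.
have mgf0 : 0 <= mgf A s by apply: expect_ge0 => // x; exact: expR_ge0.
have -> : expect q (fun x => (a i \subset x)%:R * expR (- (s * occurrences A x)))
    = pr_all q (a i) * expect q (fun x => expR (- (s * Y x)) * expR (- (s * Z x))).
  rewrite -expect_cond => [|e x ei].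
    apply: eq_expect => x; have [aix|] := boolP (a i \subset x); last by rewrite !mul0r.
    rewrite !mul1r -expRD -opprD -mulrDr; congr (expR (- (s * _))).
    rewrite /occurrences (bigID (fun j => [disjoint a i & a j])) /= addrC.
    congr (_ + _); apply: eq_bigr => j _.
    by move/finset.setUidPl : aix => ->.
  congr (expR (- (s * _)) * expR (- (s * _))); apply: eq_bigr => j.
    by move=> _; rewrite absorb.
  move=> /andP[_ ij]; congr (nat_of_bool _)%:R.
  apply/fintype.subsetP/fintype.subsetP => jx e' e'j; have := jx _ e'j; rewrite !inE.
    case: eqP => //= e'e.
    by move: ij; rewrite disjoint_sym => /pred0P/(_ e'); rewrite /= e'j e'e ei.
  by move=> ->; rewrite orbT.
apply: (@le_trans _ _ (pr_all q (a i) *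
    (expect q (fun x => expR (- (s * Y x))) * mgf A s))); last first.
  rewrite ler_wpM2l ?pr_all_ge0//; apply: le_trans (harris q01 antiY antiZ).
  rewrite ler_wpM2l//; first by apply: expect_ge0 => // x; exact: expR_ge0.
  (* Since [Z] is at most the full count, its exponential factor dominates the integrand of
     [mgf A s]. *)
  apply: le_expect => // x; rewrite ler_expR lerN2 ler_wpM2l//.
  rewrite /occurrences [leRHS](bigID (fun j => [disjoint a i & a j])) /=.
  by rewrite lerDl sumr_ge0.
rewrite mulrA ler_wpM2r//.
apply: (@le_trans _ _ (pr_all q (a i) * expect q (fun x => 1 - s * Y x))).
  rewrite -expect_cond => [|e x ei]; last first.
    by congr (1 - s * _); apply: eq_bigr => j _; rewrite absorb.
  rewrite [leRHS](@eq_expect _ _ _ _ (fun x => (a i \subset x)%:R + - s *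
    \sum_(j in A | ~~ [disjoint a i & a j]) (a i :|: a j \subset x)%:R)).
    rewrite expectD expectZ expect_sum expect_all mulNr.
    by rewrite (eq_bigr _ (fun j _ => expect_all q (a i :|: a j))).
  move=> x; rewrite mulrBr mulr1 mulNr mulrCA; congr (_ - s * _).
  rewrite mulr_sumr; apply: eq_bigr => j _; rewrite -natrM mulnb.
  rewrite finset.subUset; case: (boolP (a i \subset x)) => //= /finset.setUidPl.
  by move=> ->.
rewrite ler_wpM2l ?pr_all_ge0//; apply: le_expect => // x.
exact: expR_ge1Dx.
Qed.

(** Summation of the previous bound over [i]. The right-hand side is minus the derivative of [mgf A]
    at [s], so this is a differential inequality for [mgf A]. *)
Lemma expect_occurrences_expR (A : {set I}) (s : R) : 0 <= s ->
  (mean A - s * correlation A) * mgf A s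
  <= expect q (fun x => occurrences A x * expR (- (s * occurrences A x))).
Proof.
move=> s0.
rewrite (@eq_expect _ _ _ _ (fun x => \sum_(i in A)
  ((a i \subset x)%:R * expR (- (s * occurrences A x))))); last first.
  by move=> x; rewrite mulr_suml.
rewrite expect_sum /mean /correlation [s * _]mulr_sumr -sumrB mulr_suml.
by apply: ler_sum => i _; exact: expect_occurrence_expR.
Qed.

Lemma is_derive_expect (h : {set E} -> R -> R) (h' : {set E} -> R) (s : R) :
  (forall x, is_derive s 1 (h x) (h' x)) ->
  is_derive s 1 (fun t => expect q (h^~ t)) (expect q h').
Proof.
move=> hh'; rewrite /expect.
elim: (index_enum _) => [|x r IH].
  rewrite big_nil (_ : (fun _ => _) = cst 0); first exact: is_derive_cst.
  by apply/funext => t; rewrite big_nil.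
rewrite big_cons (_ : (fun _ => _) = (weight q x \*: h x) +
  (fun t => \sum_(j <- r) weight q j * h j t)); first exact: is_deriveD.
by apply/funext => t; rewrite big_cons.
Qed.

(* The quotient of the two sides is nonincreasing in [s], by the previous bound on
   the derivative of the moment generating function. *)
Lemma janson_mgf (A : {set I}) (s : R) : 0 <= s ->
  mgf A s <= expR (- (s * mean A) + s ^+ 2 / 2 * correlation A).
Proof.
move=> s0; pose m := mean A; pose D := correlation A.
(* Chosen so that [expect q (h^~ t)] is [mgf A t] divided by the claimed bound at [t]. *)
pose h (x : {set E}) (t : R) : R := expR (- (t * (occurrences A x - m)) - t ^+ 2 / 2 * D).
pose h' (t : R) (x : {set E}) : R := - (occurrences A x - m + t * D) * h x t.
have dh (t : R) (x : {set E}) : is_derive t (1 : R) (h x) (h' t x).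
  pose g (u : R) := - (u * (occurrences A x - m)) - u ^+ 2 / 2 * D.
  have dg : is_derive t 1 g (- (occurrences A x - m + t * D)).
    rewrite /g; apply: is_derive_eq; rewrite /GRing.scale /= !(mulr0, add0r, mulr1).
    by field.
  by have := is_derive1_comp (is_derive_expR (g t)) dg; rewrite mulrC.
have dF t := is_derive_expect (dh t).
have h1 : expect q (h^~ 0) = 1.
  rewrite -[RHS](expect_cst q); apply: eq_expect => x.
  by rewrite /h expr0n /= !mul0r oppr0 addr0 expR0.
have hE t : expect q (h^~ t) = expR (t * m - t ^+ 2 / 2 * D) * mgf A t.
  rewrite -expectZ; apply: eq_expect => x; rewrite -expRD /h; congr expR.
  by ring.
have : expect q (h^~ s) <= expect q (h^~ 0).
  apply: (@ler0_derive1_le_cc _ (fun t => expect q (h^~ t)) 0 s) => //.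
  - move=> t; rewrite in_itv /= => /andP[t0 _].
    rewrite derive1E derive_val.
    have -> : expect q (h' t) = expR (t * m - t ^+ 2 / 2 * D) *
       ((m - t * D) * mgf A t -
        expect q (fun x => occurrences A x * expR (- (t * occurrences A x)))).
      rewrite -[X in _ * (X - _)]expectZ -mulN1r -[X in _ * (_ + X)]expectZ.
      rewrite -expectD -expectZ; apply: eq_expect => x.
      rewrite /h' /h.
      rewrite [X in expR X](_ : _ = (t * m - t ^+ 2 / 2 * D) + (- (t * occurrences A x))).
        by rewrite expRD; ring.
      by ring.
    rewrite pmulr_rle0 ?expR_gt0// subr_le0.
    exact: expect_occurrences_expR (ltW t0).
  - apply: derivable_within_continuous => t _; exact: ex_derive.
  - by rewrite in_itv /= lexx s0.
  - by rewrite in_itv /= lexx s0.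
rewrite h1 hE mulrC -ler_pdivlMr ?expR_gt0// div1r -expRN => /le_trans; apply.
by rewrite ler_expR opprB addrC.
Qed.

(** Markov's inequality for the exponential of [- (s * occurrences A x)]. A positive upper bound [W]
    replaces the correlation, which may vanish. *)
Lemma janson_lower_tail (A : {set I}) (t W : R) : 0 <= t -> 0 < W -> correlation A <= W ->
  expect q (fun x => (occurrences A x <= mean A - t)%R%:R)
  <= expR (- (t ^+ 2 / (2 * W))).
Proof.
(* This [s] minimizes [- (s * t) + s ^+ 2 / 2 * W]. *)
move=> t0 W0 DW; pose s := t / W.
have s0 : 0 <= s by rewrite divr_ge0// ltW.
apply: (@le_trans _ _ (expR (s * (mean A - t)) * mgf A s)).
  rewrite -expectZ; apply: le_expect => // x.
  have [le|_] := boolP (occurrences A x <= mean A - t); last first.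
    exact: mulr_ge0 (expR_ge0 _) (expR_ge0 _).
  by rewrite -expRD -[leLHS]expR0 ler_expR subr_ge0 ler_wpM2l.
apply: le_trans (ler_wpM2l (expR_ge0 _) (janson_mgf A s0)) _.
rewrite -expRD ler_expR.
have /le_trans : s * (mean A - t) + (- (s * mean A) + s ^+ 2 / 2 * correlation A)
   <= - (s * t) + s ^+ 2 / 2 * W.
  have : s ^+ 2 / 2 * correlation A <= s ^+ 2 / 2 * W.
    by rewrite ler_wpM2l// divr_ge0 ?sqr_ge0.
  by rewrite mulrBr; lra.
apply; rewrite le_eqVlt; apply/orP; left; apply/eqP; rewrite /s.
by field; rewrite gt_eqF.
Qed.

(** Chebyshev's inequality. In the variance, disjoint pairs are independent and cancel against the
    squared mean; the remaining pairs contribute at most the correlation. *)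
Lemma second_moment_upper_tail (A : {set I}) (t : R) : 0 < t ->
  expect q (fun x => (mean A + t <= occurrences A x)%R%:R) <= correlation A / t ^+ 2.
Proof.
move=> t0; set m := mean A.
rewrite ler_pdivlMr ?exprn_gt0// mulrC -expectZ.
apply: (@le_trans _ _ (expect q (fun x => (occurrences A x - m) ^+ 2))).
  apply: le_expect => // x.
  have [le|_] := boolP (m + t <= _); last by rewrite mulr0 sqr_ge0.
  by rewrite mulr1 ler_sqr ?nnegrE; lra.
have -> : expect q (fun x => (occurrences A x - m) ^+ 2) =
   expect q (fun x => occurrences A x ^+ 2) - m ^+ 2.
  rewrite (@eq_expect _ _ _ _ (fun x => occurrences A x ^+ 2 +
     (- (2 * m) * occurrences A x + m ^+ 2))); last by move=> x; ring.
  by rewrite !expectD expectZ expect_occurrences expect_cst -/m; ring.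
rewrite lerBlDr (@eq_expect _ _ _ _ (fun x => \sum_(i in A) \sum_(j in A)
   (a i :|: a j \subset x)%:R)); last first.
  move=> x; rewrite expr2 mulr_suml; apply: eq_bigr => i _.
  rewrite mulr_sumr; apply: eq_bigr => j _.
  by rewrite -natrM mulnb finset.subUset.
rewrite expect_sum /correlation /m /mean expr2 mulr_suml -big_split /=.
apply: ler_sum => i _; rewrite expect_sum mulr_sumr.
rewrite (bigID (fun j => [disjoint a i & a j])) /= addrC lerD//.
  by apply: ler_sum => j _; rewrite expect_all.
rewrite [leRHS](bigID (fun j => [disjoint a i & a j])) /=.
rewrite -[leLHS]addr0 lerD//; last first.
  by apply: sumr_ge0 => j _; rewrite mulr_ge0 ?pr_all_ge0.
apply: ler_sum => j /andP[_ ij].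
by rewrite expect_all pr_allU.
Qed.

End Janson.

(** * Copies of a graph *)

Section Copies.
Variables (F : sgraph) (n : nat).
Implicit Types (phi psi : {ffun F -> 'I_n}).

(** Canonical representative of an unordered pair; for distinct vertices it is the increasing
    one. *)
Definition upair (i j : 'I_n) : 'I_n * 'I_n := if (i < j)%N then (i, j) else (j, i).

Lemma upair_inj (i j k l : 'I_n) : upair i j = upair k l ->
  (i = k /\ j = l) \/ (i = l /\ j = k).
Proof.
rewrite /upair; do 2!case: ifP => _; case=> -> ->.
- by left.
- by right.
- by right.
- by left.
Qed.

Lemma upair_lt i j : i != j -> ((upair i j).1 < (upair i j).2)%N.
Proof.
by rewrite /upair; case: (ltngtP i j) => //= /ord_inj ->; rewrite eqxx.
Qed.

Definition copy phi : {set 'I_n * 'I_n} :=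
  [set upair (phi ab.1) (phi ab.2) | ab in edges F]%SET.

Definition into (S : {set 'I_n}) : {set {ffun F -> 'I_n}} :=
  [set phi : {ffun F -> 'I_n} | injectiveb phi && [forall x, phi x \in S]]%SET.

Definition injections : {set {ffun F -> 'I_n}} :=
  [set phi : {ffun F -> 'I_n} | injectiveb phi]%SET.

Lemma into_sub S : into S \subset injections.
Proof. by apply/fintype.subsetP => phi; rewrite !inE => /andP[]. Qed.

Lemma injectionsP phi : reflect (injective phi) (phi \in injections).
Proof. by rewrite inE; exact: injectiveP. Qed.

Lemma card_into (S : {set 'I_n}) : #|into S| = #|S| ^_ #|F|.
Proof.
rewrite -card_inj_ffuns_on; apply: eq_card => phi; rewrite !inE andbC.
by congr (_ && _); apply/forallP/ffun_onP.
Qed.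

Lemma edge_adj (ab : F * F) : ab \in edges F -> adj ab.1 ab.2.
Proof. by rewrite inE => /andP[]. Qed.

Lemma card_copy phi : phi \in injections -> #|copy phi| = #|edges F|.
Proof.
move=> /injectionsP phiI; rewrite card_in_imset// => -[a b] [c d].
rewrite !inE /= => /andP[_ ab] /andP[_ cd].
case/upair_inj => -[/phiI ac /phiI bd]; first by rewrite ac bd.
by move: ab; rewrite ac bd ltnNge (ltnW cd).
Qed.

Lemma copy_lt phi e : phi \in injections -> e \in copy phi -> (e.1 < e.2)%N.
Proof.
move=> /injectionsP phiI /imsetP[[a b] /edge_adj /= ab ->]; apply: upair_lt.
by apply: contraTneq ab => /phiI ->; rewrite adj_irr.
Qed.

(** * Edges shared by two copies *)

Definition overlap phi psi : {set F} := [set a : F | psi a \in codom phi]%SET.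

(** The listed edges inside [A] and their reversals are disjoint sets of ordered adjacent pairs.
    Each vertex of [A] starts at most [minn (max_degree F) #|A|.-1] of these, as it is not its own
    neighbour. *)
Lemma card_adj_pairs (A : {set F}) :
  (2 * #|[set ab in edges F | (ab.1 \in A) && (ab.2 \in A)]%SET| <=
   #|A| * minn (max_degree F) #|A|.-1)%N.
Proof.
set B := finset _.
pose sw (ab : F * F) := (ab.2, ab.1).
have swI : injective sw by move=> [a b] [c d] [-> ->].
have dis : [disjoint B & sw @: B].
  apply/pred0P => -[a b] /=; apply/negP => /andP[].
  rewrite !inE /= => /andP[/andP[_ ab] _] /imsetP[[c d]] + [ac bd].
  rewrite !inE /= -ac -bd => /andP[/andP[_ ba] _].
  by move: (ltn_trans ab ba); rewrite ltnn.
have -> : (2 * #|B| = #|B :|: sw @: B|)%N.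
  by rewrite cardsU disjoint_setI0// cards0 subn0 card_imset// mul2n addnn.
have sub : B :|: sw @: B \subset
    [set ab : F * F | (ab.1 \in A) && (ab.2 \in A :&: [set b | adj ab.1 b])]%SET.
  apply/fintype.subsetP => -[a b]; rewrite !inE /= => /orP[|/imsetP[[c d]]].
    by move=> /andP[/andP[-> _] /andP[-> ->]].
  by rewrite !inE /= => /andP[/andP[cd _] /andP[Ac Ad]] [-> ->]; rewrite Ac Ad adj_sym.
apply: leq_trans (subset_leq_card sub) _.
rewrite -sum1dep_card -(pair_big_dep (mem A)
  (fun a b => b \in A :&: [set b | adj a b]%SET) (fun _ _ => 1%N)) /=.
rewrite -sum_nat_const leq_sum// => a Aa; rewrite sum1_card leq_min.
apply/andP; split.
  apply: leq_trans (leq_bigmax a) => /=.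
  by rewrite /degree subset_leq_card// finset.subsetIr.
rewrite (cardsD1 a A) Aa /= subset_leq_card//; apply/fintype.subsetP => b.
rewrite !inE => /andP[-> ab]; rewrite andbT.
by apply: contraTneq ab => ->; rewrite adj_irr.
Qed.

(** A shared edge is the image under [psi] of an edge whose two ends are sent into the image of
    [phi], hence of an edge inside [overlap phi psi]. *)
Lemma card_shared phi psi : (2 * #|copy phi :&: copy psi| <=
   #|overlap phi psi| * minn (max_degree F) #|overlap phi psi|.-1)%N.
Proof.
apply: leq_trans (card_adj_pairs _); rewrite leq_mul2l /=.
apply: leq_trans (leq_imset_card (fun ab => upair (psi ab.1) (psi ab.2)) _).
apply: subset_leq_card; apply/fintype.subsetP => e; rewrite inE => /andP[].
move=> /imsetP[[c d] _ ->] /imsetP[[a b] abE] /= ab.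
rewrite ab; apply/imsetP; exists (a, b) => //; rewrite inE abE /= !inE.
by case: (upair_inj ab) => -[<- <-]; rewrite !codom_f.
Qed.

Variable R : realType.

(* An edge is encoded as its increasing pair; the other pairs are never selected. *)
Definition edge_pr (p : R) (e : 'I_n * 'I_n) : R := if (e.1 < e.2)%N then p else 0.

Lemma edge_pr01 (p : R) : 0 <= p <= 1 -> forall e, 0 <= edge_pr p e <= 1.
Proof. by move=> p01 e; rewrite /edge_pr; case: ifP; rewrite // lexx ler01. Qed.

Lemma pr_all_edges (p : R) (A : {set 'I_n * 'I_n}) :
  (forall e, e \in A -> (e.1 < e.2)%N) -> pr_all (edge_pr p) A = p ^+ #|A|.
Proof.
move=> lt; rewrite /pr_all -prodr_const.
by apply: eq_bigr => e /lt; rewrite /edge_pr => ->.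
Qed.

Lemma mean_injections (p : R) (A : {set {ffun F -> 'I_n}}) : A \subset injections ->
  mean (edge_pr p) copy A = p ^+ #|edges F| * #|A|%:R.
Proof.
move=> /fintype.subsetP Ai; rewrite /mean mulr_natr -sumr_const.
by apply: eq_bigr => phi /Ai phiI; rewrite pr_all_edges ?card_copy// => e /copy_lt; exact.
Qed.

(* Dropping the injectivity of [psi], the sum factorizes over the vertices of [F]. *)
Lemma sum_overlap phi (c : R) : 0 <= c ->
  \sum_(psi : {ffun F -> 'I_n}) c ^+ #|overlap phi psi| <= (n%:R + #|F|%:R * c) ^+ #|F|.
Proof.
move=> c0.
have -> : \sum_(psi : {ffun F -> 'I_n}) c ^+ #|overlap phi psi| =
    \sum_(psi : {ffun F -> 'I_n}) \prod_(a : F) (if psi a \in codom phi then c else 1).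
  apply: eq_bigr => psi _; rewrite -big_mkcond /= -prodr_const.
  by apply: eq_bigl => a; rewrite inE.
rewrite -(bigA_distr_bigA (fun (a : F) i => if i \in codom phi then c else 1)).
rewrite -prodr_const; apply: ler_prod => a _.
apply/andP; split; first by apply: sumr_ge0 => i _; case: ifP.
rewrite (bigID (mem (codom phi))) /= addrC; apply: lerD.
  rewrite (eq_bigr (fun=> 1)) => [|i /negPf -> //]; rewrite sumr_const ler_nat.
  by rewrite -[leqRHS]card_ord; exact: max_card.
rewrite (eq_bigr (fun=> c)) => [|i -> //]; rewrite sumr_const -[c *+ _]mulr_natl.
by rewrite ler_wpM2r// ler_nat leq_image_card.
Qed.

(** Let [k] vertices and [m] edges be shared. For [k >= 3], [2 * m <= max_degree F * k] bounds the
    left side by [y ^+ k], and all but three factors [y] are replaced by [n]. For [k = 2] a single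
    edge is shared, which gives the second term. *)
Lemma shared_pr (p y : R) phi psi : 0 < p <= 1 -> (2 <= max_degree F)%N ->
  p ^- max_degree F <= y ^+ 2 -> 0 < y <= n%:R ->
  ~~ [disjoint copy phi & copy psi] ->
  p ^- #|copy phi :&: copy psi| <=
  n%:R ^+ #|overlap phi psi| * ((y / n%:R) ^+ 3 + y / n%:R ^+ 2).
Proof.
move=> /andP[p0 p1] D2 py /andP[y0 yn]; rewrite -setI_eq0 -card_gt0.
have := card_shared phi psi.
set m := #|copy phi :&: copy psi|; set k := #|overlap phi psi| => mk m0.
have n0 : 0 < n%:R :> R by exact: lt_le_trans yn.
have y0' := ltW y0.
have P1 : 1 <= p^-1 by rewrite invf_ge1.
have pP j : p ^- j = (p^-1) ^+ j by rewrite exprVn.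
rewrite pP; move: py; rewrite pP => py.
have [k3|k2] := leqP 3 k.
  have y1 : 1 <= y ^+ 2 by apply: le_trans py; rewrite exprn_ege1.
  apply: (@le_trans _ _ (y ^+ k)).
    rewrite -ler_sqr ?nnegrE ?exprn_ge0 ?invr_ge0 ?(ltW p0)//.
    apply: (@le_trans _ _ (p^-1 ^+ (max_degree F * k))).
      rewrite -exprM mulnC; apply: ler_weXn2l => //; apply: leq_trans mk _.
      by rewrite mulnC leq_mul2r geq_minl orbT.
    rewrite exprM -[leRHS]exprM [(k * 2)%N]mulnC [leRHS]exprM.
    apply: lerXn2r => //; first by rewrite nnegrE exprn_ge0 ?invr_ge0 ?ltW.
    by rewrite nnegrE sqr_ge0.
  rewrite mulrDr -[leLHS]addr0 lerD//; last first.
    by rewrite mulr_ge0 ?exprn_ge0 ?divr_ge0 ?exprn_ge0 ?ltW.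
  have [j ->] : exists j, k = (3 + j)%N by exists (k - 3)%N; rewrite subnKC.
  rewrite !exprD expr_div_n [leRHS](_ : _ = y ^+ 3 * n%:R ^+ j); last first.
    by field; rewrite gt_eqF.
  rewrite ler_wpM2l ?exprn_ge0//.
  by apply: lerXn2r => //; rewrite nnegrE ltW.
have mk1 : (2 * m <= k * k.-1)%N.
  by apply: leq_trans mk _; rewrite leq_mul2l geq_minr orbT.
(* At least one edge is shared and [2 * m <= k * k.-1], which excludes [k < 2] and then forces
   [m = 1]. *)
have {}k2 : k = 2%N.
  by clear -k2 mk1 m0; case: k k2 mk1 => [|[|[|]]]//; lia.
have -> : m = 1%N by clear -k2 mk1 m0; lia.
rewrite k2 mulrDr -[leLHS]add0r lerD//.
  by rewrite mulr_ge0 ?exprn_ge0 ?divr_ge0 ?exprn_ge0 ?ltW.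
rewrite mulrC divfK ?expf_neq0 ?gt_eqF//.
rewrite expr1 -ler_sqr ?nnegrE ?invr_ge0 ?(ltW p0)//.
by apply: le_trans py; exact: ler_weXn2l.
Qed.

(** Two copies sharing [m] edges are both present with probability [p ^+ (2 * #|edges F| - m)].
    After [shared_pr], the sum over [psi] is [sum_overlap] with [c = n], and there are at most
    [n ^ #|F|] choices of [phi]. *)
Lemma correlation_injections (p y : R) : 0 < p <= 1 -> (2 <= max_degree F)%N ->
  p ^- max_degree F <= y ^+ 2 -> 0 < y <= n%:R ->
  correlation (edge_pr p) copy injections <=
  (n%:R ^+ #|F| * p ^+ #|edges F|) ^+ 2 *
  ((1 + #|F|%:R) ^+ #|F| * ((y / n%:R) ^+ 3 + y / n%:R ^+ 2)).
Proof.
move=> p01 D2 py yn; have /andP[p0 p1] := p01; have /andP[y0 _] := yn.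
have p0' := ltW p0; have y0' := ltW y0.
set b := (y / n%:R) ^+ 3 + y / n%:R ^+ 2.
have b0 : 0 <= b by rewrite addr_ge0 ?exprn_ge0 ?divr_ge0 ?exprn_ge0.
apply: (@le_trans _ _ (\sum_(phi in injections) \sum_(psi : {ffun F -> 'I_n})
   p ^+ #|edges F| ^+ 2 * b * n%:R ^+ #|overlap phi psi|)).
  apply: ler_sum => phi phiI; rewrite [leRHS](bigID (fun psi =>
     (psi \in injections) && ~~ [disjoint copy phi & copy psi])) /=.
  rewrite -[leLHS]addr0 lerD//; last first.
    by apply: sumr_ge0 => psi _; rewrite !mulr_ge0 ?exprn_ge0//.
  apply: ler_sum => psi /andP[psiI meet].
  rewrite pr_all_edges; last by move=> e; rewrite inE => /orP[] /copy_lt; exact.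
  have := shared_pr p01 D2 py yn meet; rewrite -/b mulrC => le.
  rewrite -[leRHS]mulrA; apply: le_trans (ler_wpM2l _ le); last first.
    by rewrite !exprn_ge0.
  rewrite ler_pdivlMr ?exprn_gt0// -exprD.
  by rewrite cardsUI !card_copy// -exprM muln2 addnn.
apply: (@le_trans _ _ (\sum_(phi in injections)
    p ^+ #|edges F| ^+ 2 * b * (n%:R + #|F|%:R * n%:R) ^+ #|F|)).
  apply: ler_sum => phi _; rewrite -mulr_sumr ler_wpM2l ?sum_overlap//.
  by rewrite mulr_ge0// !exprn_ge0//.
rewrite sumr_const -[leLHS]mulr_natl.
apply: (@le_trans _ _ (n%:R ^+ #|F| *
    (p ^+ #|edges F| ^+ 2 * b * (n%:R + #|F|%:R * n%:R) ^+ #|F|))).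
  rewrite ler_wpM2r//; last first.
    rewrite -natrX ler_nat; apply: leq_trans (max_card _) _.
    by rewrite card_ffun card_ord.
  by rewrite !mulr_ge0 ?exprn_ge0 ?addr_ge0 ?mulr_ge0//.
rewrite [n%:R + _](_ : _ = n%:R * (1 + #|F|%:R)); last by ring.
by rewrite exprMn le_eqVlt; apply/orP; left; apply/eqP; ring.
Qed.

End Copies.

(** * Graphs on ['I_n] as sets of increasing pairs *)

Section EdgeSets.
Variable n : nat.
Implicit Types (x : {set 'I_n * 'I_n}) (g : rel 'I_n).

Definition edge_set g : {set 'I_n * 'I_n} :=
  [set e : 'I_n * 'I_n | (e.1 < e.2)%N && g e.1 e.2]%SET.

Definition graph_of x : rel 'I_n := fun i j => upair i j \in x.

Lemma edge_setK g : symmetric g -> irreflexive g -> graph_of (edge_set g) = g.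
Proof.
move=> gC gI; apply/funext => i; apply/funext => j; rewrite /graph_of inE.
have [->|ij] := eqVneq i j; first by rewrite /upair ltnn /= ltnn gI.
by rewrite upair_lt//= /upair; case: ifP => //= _; rewrite gC.
Qed.

(** The product over the edges is the indicator that the whole copy lies in [x]. *)
Lemma inj_count_graph_of (R : realType) (F : sgraph) (S : {set 'I_n}) x :
  (inj_count F S (graph_of x))%:R = occurrences R (@copy F n) (into F S) x.
Proof.
rewrite /inj_count /occurrences natr_sum; apply: eq_big => phi; first by rewrite inE.
move=> _; congr (_%:R).
have [sub|] := boolP (copy phi \subset x).
  rewrite big1// => ab abE; apply/eqP; rewrite eqb1; apply: (fintype.subsetP sub).
  by apply/imsetP; exists ab.
move=> /fintype.subsetPn[e /imsetP[ab abE ->] /negPf abx].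
by rewrite (bigD1 ab)//= /graph_of abx.
Qed.

Definition pairs_lt : {set 'I_n * 'I_n} :=
  [set e : 'I_n * 'I_n | (e.1 < e.2)%N]%SET.

Lemma mem_pairs_lt e : (e \in pairs_lt) = (e.1 < e.2)%N.
Proof. by rewrite inE. Qed.

Lemma mem_edge_set g e : (e \in edge_set g) = (e.1 < e.2)%N && g e.1 e.2.
Proof. by rewrite inE. Qed.

End EdgeSets.

(** * Tail bound for the supremum over vertex subsets *)

Section SupDeviationTail.
Variables (R : realType) (F : sgraph) (n : nat) (p : R).
Hypotheses (p01 : 0 < p <= 1) (n_gt0 : (0 < n)%N).

Let occ (A : {set {ffun F -> 'I_n}}) x : R := occurrences R (@copy F n) A x.
Let mu (A : {set {ffun F -> 'I_n}}) : R := mean (edge_pr p) (@copy F n) A.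
Let away (S : {set 'I_n}) := injections F n :\: into F S.

Let occ_split S x : occ (injections F n) x = occ (into F S) x + occ (away S) x.
Proof.
by rewrite /occ /occurrences (big_setID (into F S)) (finset.setIidPr (into_sub F S)).
Qed.

Let mu_split S : mu (injections F n) = mu (into F S) + mu (away S).
Proof.
by rewrite /mu /mean (big_setID (into F S)) (finset.setIidPr (into_sub F S)).
Qed.

(* The upper bound for [into F S] comes from the lower bound for its complement
   in the set of all injections. *)
Lemma sup_deviation_le (eps t : R) x : 0 <= eps ->
  2 * t = eps * (n%:R ^+ #|F| * p ^+ #|edges F|) ->
  (forall S, mu (into F S) - t < occ (into F S) x) ->
  (forall S, mu (away S) - t < occ (away S) x) ->
  occ (injections F n) x < mu (injections F n) + t ->
  sup_deviation F p (graph_of x) <= eps.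
Proof.
move=> eps0 tE lo1 lo2 up; have /andP[p0 _] := p01.
rewrite /sup_deviation; elim/big_ind: _ => // [u v ue ve|S _].
  by rewrite ge_max ue ve.
have n0 : 0 < n%:R :> R by rewrite ltr0n.
have M0 : 0 < n%:R ^+ #|F| * p ^+ #|edges F| by rewrite mulr_gt0 ?exprn_gt0.
have -> : n%:R ^- #|F| * `|p ^- #|edges F| * (inj_count F S (graph_of x))%:R
     - (#|S| ^_ #|F|)%:R|
   = `|occ (into F S) x - mu (into F S)| / (n%:R ^+ #|F| * p ^+ #|edges F|).
  rewrite inj_count_graph_of /mu (mean_injections _ (into_sub F S)) card_into.
  have pe0 : 0 < p ^+ #|edges F| by rewrite exprn_gt0.
  set N := occurrences _ _ _ _; set s := (_ ^_ _)%:R.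
  have -> : p ^- #|edges F| * N - s = (N - p ^+ #|edges F| * s) / p ^+ #|edges F|.
    by rewrite mulrBl [p ^+ _ * s]mulrC mulfK ?gt_eqF// mulrC.
  rewrite normrM normfV (gtr0_norm pe0); move: `|_| => w.
  by field; rewrite !gt_eqF// exprn_gt0.
rewrite ler_pdivrMr// -tE ler_norml.
(* The upper side adds the excess [t] of the total to the deficit [t] of [away S], whence the factor
   2 in [tE]. *)
have := lo1 S; have := lo2 S; move: up; rewrite (occ_split S) (mu_split S).
by move=> *; apply/andP; split; lra.
Qed.

(** Union bound: Janson's inequality for two families per subset [S], giving the factor
    [2 * 2 ^+ n], plus Chebyshev's inequality once for the total. *)
Lemma sup_deviation_tail (eps B : R) : 0 < eps -> 0 < B ->
  correlation (edge_pr p) (@copy F n) (injections F n) <=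
    (n%:R ^+ #|F| * p ^+ #|edges F|) ^+ 2 * B ->
  expect (edge_pr p) (fun x : {set 'I_n * 'I_n} =>
    (eps < sup_deviation F p (graph_of x))%R%:R) <=
    2 * 2 ^+ n * expR (- (eps ^+ 2 / (8 * B))) + 4 * B / eps ^+ 2.
Proof.
move=> eps0 B0; set M := n%:R ^+ #|F| * p ^+ #|edges F| => corr.
have /andP[p0 p1] := p01.
have p01' : forall e : 'I_n * 'I_n, 0 <= edge_pr p e <= 1.
  by apply: edge_pr01; rewrite ltW.
have M0 : 0 < M by rewrite mulr_gt0 ?exprn_gt0 ?ltr0n.
pose t := eps * M / 2.
have t0 : 0 < t by apply: divr_gt0; rewrite ?ltr0n//; apply: mulr_gt0.
have W0 : 0 < M ^+ 2 * B by rewrite mulr_gt0 ?exprn_gt0.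
pose low (A : {set {ffun F -> 'I_n}}) x : R := (occ A x <= mu A - t)%R%:R.
pose upp x : R := (mu (injections F n) + t <= occ (injections F n) x)%R%:R.
have lowE (A : {set {ffun F -> 'I_n}}) : A \subset injections F n ->
    expect (edge_pr p) (low A) <= expR (- (eps ^+ 2 / (8 * B))).
  move=> Ai; have := janson_lower_tail p01' (ltW t0) W0
    (le_trans (le_correlation p01' (@copy F n) Ai) corr).
  rewrite (_ : t ^+ 2 / _ = eps ^+ 2 / (8 * B))// /t.
  by field; rewrite !gt_eqF.
have uppE : expect (edge_pr p) upp <= 4 * B / eps ^+ 2.
  apply: (le_trans (second_moment_upper_tail p01' (@copy F n) (injections F n) t0)).
  rewrite ler_pdivrMr ?exprn_gt0//; apply: le_trans corr _.
  rewrite le_eqVlt; apply/orP; left; apply/eqP; rewrite /t.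
  by field; rewrite gt_eqF.
apply: (@le_trans _ _ (expect (edge_pr p) (fun x =>
    \sum_(S : {set 'I_n}) (low (into F S) x + low (away S) x) + upp x))).
  apply: le_expect => // x.
  have sum0 : 0 <= \sum_(S : {set 'I_n}) (low (into F S) x + low (away S) x).
    by apply: sumr_ge0 => S _; rewrite addr_ge0 ?ler0n.
  have [dev|_] := boolP (eps < _); last by rewrite addr_ge0 ?ler0n.
  have [up|up] := boolP (mu (injections F n) + t <= occ (injections F n) x).
    by rewrite /upp up lerDr.
  have [S lo] : exists S, (occ (into F S) x <= mu (into F S) - t) \/
      (occ (away S) x <= mu (away S) - t).
    apply: contrapT => /forallNP no; move: dev; rewrite ltNge => /negP; apply.
    apply: (@sup_deviation_le _ t) => //; first exact: ltW.
    - by rewrite /t -/M; field.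
    - by move=> S; rewrite ltNge; apply/negP => lo; apply: (no S); left.
    - by move=> S; rewrite ltNge; apply/negP => lo; apply: (no S); right.
    - by rewrite ltNge.
  rewrite (bigD1 S)//= -addrA [leLHS](_ : _ = 1 + 0); last by rewrite addr0.
  rewrite lerD//.
    by rewrite /low; case: lo => ->; rewrite ?lerDl ?lerDr.
  by rewrite addr_ge0// sumr_ge0// => S' _; rewrite addr_ge0 ?ler0n.
rewrite expectD lerD// expect_sum.
apply: (@le_trans _ _ (\sum_(S : {set 'I_n}) 2 * expR (- (eps ^+ 2 / (8 * B))))).
  apply: ler_sum => S _; rewrite expectD mulr_natl mulr2n.
  by rewrite lerD// lowE// ?into_sub// finset.subsetDl.
rewrite sumr_const -[X in X <= _]mulr_natl -cardsT -powersetT card_powerset cardsT.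
rewrite card_ord natrX.
by rewrite mulrA [2 ^+ n * _]mulrC.
Qed.

End SupDeviationTail.


(** * The random graph *)

Local Open Scope classical_set_scope.
Local Open Scope ring_scope.

Section ErdosRenyi.
Variables (R : realType) (d : measure_display) (T : measurableType d).
Variables (P : probability T R) (n : nat) (p : R).
Variable G : 'I_n -> 'I_n -> {RV P >-> bool}.
Hypotheses (p01 : 0 <= p <= 1) (GP : erdos_renyi p G).

Let E w := edge_set (fun i j => G i j w).

Lemma pr_edge (i j : 'I_n) b : (i < j)%N ->
  P (G i j @^-1` [set b]) = (if b then p else 1 - p)%:E.
Proof.
case: GP => _ _ dist _ ij; have := dist i j ij [set b].
rewrite /distribution /pushforward => ->.
(* The range condition [p01] selects the genuine Bernoulli branch of [bernoulli_prob]. *)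
by rewrite /bernoulli_prob p01 fsbig_set1.
Qed.

Lemma edge_set_fiber (x : {set 'I_n * 'I_n}) : x \subset pairs_lt n ->
  E @^-1` [set x] = \bigcap_(e in [set` pairs_lt n]) (G e.1 e.2 @^-1` [set e \in x]).
Proof.
move=> /fintype.subsetP xD; apply/seteqP; split => w /=.
  by move=> <- e /=; rewrite mem_pairs_lt => eD; rewrite /E mem_edge_set eD.
move=> h; apply/finset.setP => e; rewrite /E mem_edge_set.
have [eD|eD] := boolP (e \in pairs_lt n).
  by have /= -> := h e eD; move: eD; rewrite mem_pairs_lt => ->.
move: (eD); rewrite mem_pairs_lt => /negPf ->.
by apply/esym/negbTE; apply: contra eD => /xD.
Qed.

Lemma edge_set_fiber0 (x : {set 'I_n * 'I_n}) : ~~ (x \subset pairs_lt n) ->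
  E @^-1` [set x] = set0.
Proof.
move=> xD; apply/seteqP; split => w //= Ex; move/negP: xD; apply.
by rewrite -Ex; apply/fintype.subsetP => e; rewrite mem_edge_set mem_pairs_lt => /andP[].
Qed.

Lemma measurable_edge_set_fiber (x : {set 'I_n * 'I_n}) : measurable (E @^-1` [set x]).
Proof.
have [xD|xD] := boolP (x \subset pairs_lt n); last by rewrite edge_set_fiber0.
rewrite edge_set_fiber//; apply: fin_bigcap_measurable => [|e _].
  exact: finite_finset.
by apply: measurable_funPTI.
Qed.

(** Independence turns the intersection of edge events into a product. Non-increasing pairs have
    parameter 0: they contribute a factor 1 when absent and make the weight vanish when present. *)
Lemma pr_edge_set x : P (E @^-1` [set x]) = (weight (edge_pr p) x)%:E.
Proof.
have [xD|xD] := boolP (x \subset pairs_lt n); last first.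
  rewrite edge_set_fiber0// measure0; move/fintype.subsetPn : xD => [e ex eD].
  rewrite /weight (bigD1 e)//= ex /edge_pr ifF ?mul0r//.
  by move: eD; rewrite mem_pairs_lt => /negPf.
rewrite edge_set_fiber//; case: GP => _ _ _ ind.
rewrite (ind (pairs_lt n) (fun e => [set e \in x]))//.
rewrite (eq_bigr (fun e => (if e \in x then p else 1 - p)%:E)); last first.
  by move=> e; rewrite mem_pairs_lt => eD; rewrite pr_edge.
rewrite prodEFin; congr (_%:E); rewrite /weight [RHS](bigID (mem (pairs_lt n))) /=.
rewrite [X in _ = _ * X]big1 ?mulr1; last first.
  move=> e eD; have /negPf -> : e \notin x.
    by apply: contra eD; exact: (fintype.subsetP xD).
  by move: eD; rewrite /edge_pr mem_pairs_lt => /negPf ->; rewrite subr0.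
by apply: eq_bigr => e; rewrite /edge_pr mem_pairs_lt => ->.
Qed.

(** The bridge from the probability space to finite sums: the event splits into finitely many
    disjoint fibers of the edge set. *)
Lemma pr_edge_set_event (Q : pred {set 'I_n * 'I_n}) :
  P [set w | Q (E w)] = (expect (edge_pr p) (fun x => (Q x)%:R))%:E.
Proof.
have -> : [set w | Q (E w)] = \bigcup_(x in [set` Q]) (E @^-1` [set x]).
  by apply/seteqP; split => [w Qw|w [x /= Qx Ex]]; [exists (E w)|rewrite /= Ex].
rewrite measure_fin_bigcup.
- rewrite -(@bigfs _ _ _ _ (index_enum {set 'I_n * 'I_n}))/=; last 2 first.
  + exact: index_enum_uniq.
  + by move=> x _; rewrite mem_index_enum.
  rewrite (eq_bigr _ (fun x _ => pr_edge_set x)) sumEFin; congr (_%:E).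
  rewrite /expect big_mkcond; apply: eq_bigr => x _.
  by case: (Q x); rewrite ?mulr1 ?mulr0.
- exact: finite_finset.
- by move=> x y _ _ [w [/= <- <-]].
- by move=> x _; exact: measurable_edge_set_fiber.
Qed.

End ErdosRenyi.

(** * Elementary facts, including the case of an empty graph *)

Lemma max_degree_ge2 (F : sgraph) : (0 < #|F|)%N -> min_degree_ge2 F ->
  (2 <= max_degree F)%N.
Proof.
by move=> /card_gt0P[a _] F2; apply: leq_trans (F2 a) _; exact: leq_bigmax.
Qed.

(** The only map is the empty one and the falling factorial of order 0 is 1, so every deviation is
    exactly 0. *)
Lemma sup_deviation_empty (R : realType) (F : sgraph) (n : nat) (p : R)
  (g : rel 'I_n) : #|F| = 0%N -> sup_deviation F p g = 0.
Proof.
move=> F0; have noF (x : F) : False by have := max_card (pred1 x); rewrite card1 F0.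
have edges0 : edges F = finset.set0 by apply/finset.setP => -[x]; case: (noF x).
apply: big1_idem => [|S _]; first exact: maxxx.
have -> : inj_count F S g = 1%N.
  rewrite /inj_count (eq_bigl xpredT) => [|phi]; last first.
    apply/andP; split; last by apply/forallP => x; case: (noF x).
    by apply/injectiveP => x; case: (noF x).
  rewrite (eq_bigr (fun=> 1%N)) => [|phi _]; last by rewrite edges0 big_set0.
  by rewrite sum1_card card_ffun F0 expn0.
by rewrite F0 edges0 cards0 !expr0 invr1 mulr1 ffactn0 subrr normr0 mulr0.
Qed.

Lemma sup_deviation_ge0 (R : realType) (F : sgraph) (n : nat) (p : R)
  (g : rel 'I_n) : 0 <= sup_deviation F p g.
Proof.
apply: (big_ind (fun y => 0 <= y)) => // u v u0 v0.
by rewrite [0 <= _]le_max u0.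
Qed.

(** * Numerical estimates in terms of the eighth root of [n] *)

Section Asymptotics.
Variable R : realType.

Lemma ln_le_sqr (z : R) : 8 <= z -> ln (z ^+ 8) <= z ^+ 2.
Proof.
move=> z8; have z0 : 0 < z by apply: lt_le_trans z8.
rewrite lnXn// -mulr_natl expr2; apply: ler_pM => //.
  by rewrite ln_ge0//; apply: le_trans z8; rewrite ler1n.
exact: ltW (ln_sublinear z0).
Qed.

(* Here [z] is the eighth root of [n], so that [z ^+ 5] stands for [n ^ (5/8)]. *)
Lemma much_less_lower_bound (D n : nat) (z p : R) : (0 < D)%N -> 8 <= z ->
  n%:R = z ^+ 8 -> 0 < p -> (n%:R * ln n%:R) `^ (- D%:R^-1) / p <= 1 ->
  p ^- D <= (z ^+ 5) ^+ 2.
Proof.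
move=> D0 z8 nz p0; have z0 : 0 < z by apply: lt_le_trans z8.
have z1 : 1 < z by apply: lt_le_trans z8; rewrite ltr1n.
set X := n%:R * ln n%:R.
have X0 : 0 < X by rewrite mulr_gt0 ?ln_gt0// nz ?exprn_gt0// exprn_egt1.
rewrite ler_pdivrMr// mul1r => Xp.
have XV : X^-1 <= p ^+ D.
  have -> : X^-1 = (X `^ (- D%:R^-1)) ^+ D.
    rewrite -powR_mulrn ?powR_ge0// -powRrM mulNr mulVf ?pnatr_eq0 -?lt0n//.
    by rewrite powRN powRr1// ltW.
  by apply: lerXn2r => //; rewrite nnegrE ?powR_ge0 ?ltW.
rewrite -[leRHS]invrK lef_pV2 ?posrE ?invr_gt0 ?exprn_gt0//.
apply: le_trans XV; rewrite lef_pV2 ?posrE ?exprn_gt0//.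
(* Exponent 10 splits as 8 for [n] and 2 for the logarithm. *)
rewrite /X nz -exprM (_ : (5 * 2 = 8 + 2)%N)// exprD.
by rewrite ler_wpM2l ?exprn_ge0 ?ln_le_sqr// ltW.
Qed.

(** Here [z ^+ 9 = n * z], so for [z >= 16 * c / eps ^+ 2] the exponent is at most [- (2 * n)]. This
    beats [2 ^+ n <= expR n] and leaves [expR (- n) <= 1 / n]. *)
Lemma tail_bound_small (n : nat) (eps c z : R) : (0 < n)%N -> 0 < eps -> 0 < c ->
  n%:R = z ^+ 8 -> 1 <= z -> 16 * c / eps ^+ 2 <= z ->
  2 * 2 ^+ n * expR (- (eps ^+ 2 / (8 * (c / z ^+ 9)))) +
    4 * (c / z ^+ 9) / eps ^+ 2 <= 3 / n%:R.
Proof.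
move=> n0 eps0 c0 nz z1 cz.
have z0 : 0 < z by apply: lt_le_trans z1.
have n0' : 0 < n%:R :> R by rewrite ltr0n.
have e20 : 0 < eps ^+ 2 by rewrite exprn_gt0.
have cz' : 16 * c <= z * eps ^+ 2 by rewrite -ler_pdivrMr.
have z9 : z ^+ 9 = n%:R * z by rewrite nz -exprSr.
have -> : 3 / n%:R = 2 / n%:R + 1 / n%:R :> R by rewrite -mulrDl; congr (_ / _); lra.
apply: lerD; last first.
  rewrite z9 [leLHS](_ : _ = (4 * c / (z * eps ^+ 2)) / n%:R); last first.
    by field; rewrite !gt_eqF.
  rewrite ler_wpM2r ?invr_ge0 ?ler0n// ler_pdivrMr ?mulr_gt0//; lra.
rewrite -mulrA ler_wpM2l//.
have e2 : 2 ^+ n <= expR n%:R :> R.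
  rewrite -[n%:R]mulr1 expRM_natl.
  apply: lerXn2r; rewrite ?nnegrE ?expR_ge0//.
  by apply: le_trans (expR_ge1Dx _); lra.
apply: (@le_trans _ _ (expR n%:R * expR (- (2 * n%:R)))).
  apply: ler_pM; rewrite ?exprn_ge0 ?expR_ge0// ler_expR lerN2.
  rewrite z9 ler_pdivlMr; last by rewrite mulr_gt0// divr_gt0// mulr_gt0.
  rewrite [leLHS](_ : _ = 16 * c / z); last by field; rewrite !gt_eqF.
  by rewrite ler_pdivrMr// [leRHS]mulrC.
rewrite -expRD [X in expR X](_ : _ = - n%:R); last by ring.
rewrite expRN lef_pV2 ?posrE ?expR_gt0//.
by apply: le_trans (expR_ge1Dx _); rewrite lerDr.
Qed.

End Asymptotics.

Theorem lemma3p6 (R : realType) (H : sgraph) (K : subgraph H)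
  (hv : (2 <= #|H|)%N) (hconn : connected_graph H) (htree : ~ is_tree H)
  (hK : is_two_core K)
  (p : nat -> R) (hp01 : forall n, 0 <= p n <= 1)
  (hlow : much_less
     (fun n => (n%:R * ln n%:R) `^ (- (max_degree K)%:R^-1)) p)
  (hup : much_less p (fun=> 1))
  (d : nat -> measure_display) (T : forall n, measurableType (d n))
  (P : forall n, probability (T n) R)
  (G : forall n, 'I_n -> 'I_n -> {RV (P n) >-> bool})
  (hG : forall n, erdos_renyi (p n) (G n)) :
  cvg_in_probability P
    (fun n w => sup_deviation K (p n) (fun i j => G n i j w)) 0.
Proof.
move=> eps eps0.
pose f n : R := expect (@edge_pr n R (p n)) (fun x : {set 'I_n * 'I_n} =>
  (eps < sup_deviation K (p n) (graph_of x))%R%:R).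
have Pf n : P n [set w | eps <
    `|sup_deviation K (p n) (fun i j => G n i j w) - 0|] = (f n)%:E.
  rewrite -(pr_edge_set_event (hp01 n) (hG n)
    (fun x => eps < sup_deviation K (p n) (graph_of x))).
  congr (P n _); apply: eq_set => w; case: (hG n) => sym irr _ _.
  rewrite edge_setK ?subr0 ?ger0_norm ?sup_deviation_ge0//.
rewrite (eq_fun Pf); apply: cvg_EFin; first by near=> n.
have [K0|K0] := eqVneq #|K| 0%N.
  apply: cvg_near_cst; near=> n.
  rewrite /f -[RHS](expect_cst (@edge_pr n R (p n))); apply: eq_expect => x.
  by rewrite sup_deviation_empty// ltNge ltW.
have D2 : (2 <= max_degree K)%N by apply: max_degree_ge2 (proj1 hK); rewrite lt0n.
(* With [y = z ^+ 5], the two terms of the correlation bound are the inverses of [z ^+ 9] and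
   [z ^+ 11]; the factor 2 bounds both by the first. *)
pose c : R := 2 * (1 + #|K|%:R) ^+ #|K|.
have c0 : 0 < c by rewrite mulr_gt0// exprn_gt0// ltr_pwDl.
pose z n : R := n%:R `^ 8^-1.
have fE : \forall n \near \oo, f n <= 6 * harmonic n.
  pose m : R := Num.max 8 (16 * c / eps ^+ 2).
  near=> n.
  have zn : n%:R = z n ^+ 8.
    by rewrite /z -powR_mulrn ?powR_ge0// -powRrM mulVf// powRr1.
  have n0 : (0 < n)%N by near: n; exact: nbhs_infty_gt.
  have m0 : 0 <= m by rewrite le_max ler0n.
  have mz : m <= z n.
    have : m ^+ 8 <= z n ^+ 8 by rewrite -zn; near: n; exact: nbhs_infty_ger.
    by rewrite ler_pXn2r// nnegrE ?powR_ge0.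
  have /andP[z8 cz] : (8 <= z n) && (16 * c / eps ^+ 2 <= z n).
    by rewrite -ge_max.
  have z0 : 0 < z n by apply: lt_le_trans z8.
  have z1 : 1 <= z n by apply: le_trans z8; rewrite ler1n.
  have pn0 : p n != 0 by near: n; exact: (proj1 hlow).
  have /andP[p0 p1] := hp01 n; have {pn0}p0 : 0 < p n by rewrite lt_def pn0.
  have n0' : 0 < n%:R :> R by rewrite ltr0n.
  have pz : p n ^- max_degree K <= (z n ^+ 5) ^+ 2.
    apply: (@much_less_lower_bound _ _ n) => //; first exact: ltnW.
    (* The ratio in [hlow] tends to 0, hence is eventually at most 1. *)
    by near: n; exact: cvgr_le (proj2 hlow) _ ltr01.
  have zn5 : 0 < z n ^+ 5 <= n%:R.
    by rewrite exprn_gt0//= zn ler_weXn2l.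
  have p01 : 0 < p n <= 1 by rewrite p0.
  apply: (@le_trans _ _ (3 / n%:R)).
    apply: le_trans (tail_bound_small n0 eps0 c0 zn z1 cz).
    apply: sup_deviation_tail => //; first by rewrite divr_gt0 ?exprn_gt0.
    apply: le_trans (correlation_injections p01 D2 pz zn5) _.
    rewrite ler_wpM2l ?sqr_ge0// /c -mulrA mulrCA ler_wpM2l ?exprn_ge0 ?addr_ge0//.
    have -> : (z n ^+ 5 / n%:R) ^+ 3 = (z n ^+ 9)^-1.
      by rewrite zn; field; rewrite gt_eqF.
    have -> : z n ^+ 5 / n%:R ^+ 2 = (z n ^+ 11)^-1.
      by rewrite zn; field; rewrite gt_eqF.
    rewrite mulr_natl mulr2n lerD2l lef_pV2 ?posrE ?exprn_gt0//.
    by rewrite ler_weXn2l.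
  (* [harmonic n] is the inverse of [n + 1], and [n + 1 <= 2 * n] turns the constant 3 into 6. *)
  rewrite /harmonic ler_pdivrMr// mulrAC ler_pdivlMr ?ltr0n// -natr1.
  have : 1 <= n%:R :> R by rewrite ler1n.
  lra.
apply: (@squeeze_cvgr _ _ _ _ (cst 0) (fun n => 6 * harmonic n)).
- near=> n; apply/andP; split; last by near: n.
  by apply: expect_ge0 => [e|x]; [exact: edge_pr01|].
- exact: cvg_cst.
- by rewrite -[X in _ --> X](mulr0 6); apply: cvgM; [exact: cvg_cst|exact: cvg_harmonic].
Unshelve. all: by end_near.
Qed.
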